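(* For every triple of NOF permutation problems $I,J,K$, each over the alphabet $\{0,1\}^n$, we have $\mathrm{cc}(I\otimes J\otimes K)\le (1+o(1))n$, where $o(1)\to0$ as $n\to\infty$. In particular, for any NOF permutation problem $I$ over the alphabet $\{0,1\}^n$, $\mathrm{acc}(I)\le (1+o(1))\frac n3$.
   Context: A NOF permutation problem over alphabet $\Sigma$ is a set $I\subset\Sigma^3$ such that for any two coordinates there is exactly one value of the third coordinate giving a triple of $I$. It is viewed as a three-player promise problem over $\Gamma=\Sigma^2$ with promise $P_{NOF}=\{((i,j),(j,k),(k,i)) : i,j,k\in\Sigma\}$ (the support of the matrix multiplication tensor $\langle |\Sigma|,|\Sigma|,|\Sigma|\rangle$) and accepting set $\tilde I=\{((x,y),(y,z),(z,x)):(x,y,z)\in I\}$. For a promise problem $I'\subset P\subset A\times B\times C$ three players receive $a,b,c$ with $(a,b,c)\in P$ and must decide whether $(a,b,c)\in I'$; $\mathrm{cc}$ denotes deterministic communication complexity in the shared-blackboard model (players in cyclic order append bits depending on own input and the board, or accept/reject; input accepted iff all accept; correctness required only on $P$; cost = maximum number of bits written). The Kronecker product of promise problems $(I_1,P_1)$, $(I_2,P_2)$ is the promise problem with promise $\{((a_1,a_2),(b_1,b_2),(c_1,c_2)) : (a_i,b_i,c_i)\in P_i\}$ and accepting set $\{((a_1,a_2),(b_1,b_2),(c_1,c_2)) : (a_i,b_i,c_i)\in I_i\}$ (deciding whether both instances are accepting); $I\otimes J\otimes K$ denotes the Kronecker product of $(\tilde I,P_{NOF}),(\tilde J,P_{NOF}),(\tilde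 K,P_{NOF})$. $(I',P)^{\otimes m}$ is the $m$-fold Kronecker product, and the asymptotic communication complexity is $\mathrm{acc}(I',P)=\lim_{m\to\infty}\mathrm{cc}((I',P)^{\otimes m})/m$; $\mathrm{acc}(I)$ means $\mathrm{acc}(\tilde I,P_{NOF})$. *)

(* Defs.v *)
From mathcomp Require Import all_boot all_order all_algebra.
From mathcomp Require Import all_classical all_reals all_analysis.
From mathcomp Require Import zify ring lra.

Set Implicit Arguments.
Unset Strict Implicit.
Unset Printing Implicit Defensive.

Import Order.TTheory GRing.Theory Num.Theory.
Import numFieldNormedType.Exports.

Record problem := Problem {
  inA : finType;
  inB : finType;
  inC : finType;
  promise : {set inA * inB * inC};
  accepting : {set inA * inB * inC};
  accepting_sub : accepting \subset promise }.

Arguments promise : clear implicits.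
Arguments accepting : clear implicits.

Definition kron_set (A1 B1 C1 A2 B2 C2 : finType)
    (S1 : {set A1 * B1 * C1}) (S2 : {set A2 * B2 * C2}) :
    {set (A1 * A2) * (B1 * B2) * (C1 * C2)} :=
  [set t | let: ((a1, a2), (b1, b2), (c1, c2)) := t in
           ((a1, b1, c1) \in S1) && ((a2, b2, c2) \in S2)].

Lemma kron_sub (X Y : problem) :
  kron_set (accepting X) (accepting Y) \subset
  kron_set (promise X) (promise Y).
Proof.
apply/fintype.subsetP => -[[[a1 a2] [b1 b2]] [c1 c2]]; rewrite !inE => /andP[h1 h2].
by rewrite !(fintype.subsetP (accepting_sub _)).
Qed.

Definition kron (X Y : problem) : problem := Problem (kron_sub X Y).

(** The unit of the Kronecker product: one input, promised and accepted. *)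
Definition kron_unit : problem :=
  @Problem unit unit unit [set: _] [set: _] (subxx _).

Definition kron_pow (X : problem) (m : nat) : problem :=
  iter m (kron X) kron_unit.

(** In [protocol A B C] the player holding the input in [A] moves next; after
    his turn the roles rotate, so the players move in cyclic order.  In a turn
    the player appends a block of [n] bits to the board.  The block depends on
    his input and the board, and the rest of the protocol on the bits written.
    The length [n >= 0] depends on the board only: otherwise silence, which
    costs nothing, would convey information.  When the communication is over
    each player accepts or rejects, depending on his input and the board. *)
Inductive protocol (A B C : Type) : Type :=
| Decide of A -> bool & B -> bool & C -> bool
| Turn n of A -> n.-tuple bool & n.-tuple bool -> protocol B C A.

Fixpoint board A B C (p : protocol A B C) (a : A) (b : B) (c : C) : seq bool :=
  match p with
  | Decide _ _ _ => [::]
  | Turn _ msg next => msg a ++ board (next (msg a)) b c a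
  end.

Fixpoint accepts A B C (p : protocol A B C) (a : A) (b : B) (c : C) : bool :=
  match p with
  | Decide va vb vc => [&& va a, vb b & vc c]
  | Turn _ msg next => accepts (next (msg a)) b c a
  end.

Definition solves (X : problem) (p : protocol (inA X) (inB X) (inC X)) : Prop :=
  forall a b c, (a, b, c) \in promise X ->
    accepts p a b c = ((a, b, c) \in accepting X).

Definition cost (X : problem) (p : protocol (inA X) (inB X) (inC X)) : nat :=
  \max_(t in promise X) size (board p t.1.1 t.1.2 t.2).

Definition solvable_with (X : problem) (k : nat) : bool :=
  `[< exists2 p : protocol (inA X) (inB X) (inC X), solves p & cost p = k >].

(** The first two players can publish the characteristic vectors of their
    inputs. *)
Lemma solvable (X : problem) : exists k, solvable_with X k.
Proof.
pose enc (T : finType) (x : T) : #|T|.-tuple bool := [tuple of [seq y == x | y <- enum T]].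
have encI T : injective (@enc T).
  move=> x y /(congr1 val) /= /eq_in_map /(_ x).
  by rewrite mem_enum eqxx => /(_ isT)/esym/eqP.
pose p : protocol (inA X) (inB X) (inC X) :=
  Turn (@enc (inA X)) (fun s => Turn (@enc (inB X)) (fun t =>
   Decide (fun c => [exists a, exists b,
     [&& enc _ a == s, enc _ b == t & (a, b, c) \in accepting X]])
     (fun=> true) (fun=> true))).
exists (cost p); apply/asboolP; exists p => // a b c _ /=.
rewrite !andbT; apply/existsP/idP => [[a' /existsP[b']]|h].
  by case/and3P=> /eqP/encI -> /eqP/encI ->.
by exists a; apply/existsP; exists b; rewrite !eqxx.
Qed.

Definition cc (X : problem) : nat := ex_minn (solvable X).

(** [limn] is a total operator; here the sequence converges, see [acc_cvg]. *)
Definition acc (R : realType) (X : problem) : R :=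
  limn (fun m => (cc (kron_pow X m))%:R / m%:R : R)%R.

Record nof_perm (S : finType) := NofPerm {
  nof_set :> {set S * S * S};
  nof_perm12 : forall x y, exists! z, (x, y, z) \in nof_set;
  nof_perm23 : forall y z, exists! x, (x, y, z) \in nof_set;
  nof_perm13 : forall x z, exists! y, (x, y, z) \in nof_set }.

(** Each player misses one coordinate of [t]. *)
Definition nof_input (S : finType) (t : S * S * S) :
    (S * S) * (S * S) * (S * S) :=
  let: (x, y, z) := t in ((x, y), (y, z), (z, x)).

Definition nof_problem (S : finType) (I : nof_perm S) : problem :=
  @Problem _ _ _ (@nof_input S @: [set: S * S * S]) (@nof_input S @: I)
    (imsetS _ (finset.subsetT _)).

Lemma cc_le (X : problem) (p : protocol (inA X) (inB X) (inC X)) k :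
    solves p ->
    (forall a b c, (a, b, c) \in promise X -> size (board p a b c) <= k) ->
  cc X <= k.
Proof.
move=> sp le_k; rewrite /cc; case: ex_minnP => m _ /(_ (cost p)) le_m.
apply: leq_trans (le_m _) _; first by apply/asboolP; exists p.
by apply/bigmax_leqP => -[[a b] c] /le_k.
Qed.

Lemma cc_protocol (X : problem) :
  exists2 p : protocol (inA X) (inB X) (inC X), solves p &
    forall a b c, (a, b, c) \in promise X -> size (board p a b c) <= cc X.
Proof.
rewrite /cc; case: ex_minnP => k /asboolP[p sp <-] _; exists p => // a b c abc.
exact: (@leq_bigmax_cond _ _ (fun t => size (board p t.1.1 t.1.2 t.2)) _ abc).
Qed.

(** Runs a protocol on images of the inputs, adding a private test to each
    verdict. *)
Fixpoint pullback A B C (p : protocol A B C) A' B' C'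
    (f : A' -> A) (g : B' -> B) (h : C' -> C)
    (ta : A' -> bool) (tb : B' -> bool) (tc : C' -> bool) : protocol A' B' C' :=
  match p with
  | Decide va vb vc => Decide (fun a => ta a && va (f a))
      (fun b => tb b && vb (g b)) (fun c => tc c && vc (h c))
  | Turn _ msg next => Turn (msg \o f)
      (fun s => pullback (next s) g h f tb tc ta)
  end.

Lemma board_pullback A B C (p : protocol A B C) A' B' C'
    (f : A' -> A) (g : B' -> B) (h : C' -> C) ta tb tc a b c :
  board (pullback p f g h ta tb tc) a b c = board p (f a) (g b) (h c).
Proof.
elim: p A' B' C' f g h ta tb tc a b c => //= {}A {}B {}C n msg next IH *.
by rewrite IH.
Qed.

Lemma accepts_pullback A B C (p : protocol A B C) A' B' C'
    (f : A' -> A) (g : B' -> B) (h : C' -> C) ta tb tc a b c :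
  accepts (pullback p f g h ta tb tc) a b c =
  [&& ta a, tb b & tc c] && accepts p (f a) (g b) (h c).
Proof.
elim: p A' B' C' f g h ta tb tc a b c => [{}A {}B {}C va vb vc|{}A {}B {}C n msg next IH]
    A' B' C' f g h ta tb tc a b c /=.
  by case: (ta a) (tb b) (tc c) => [] [] [] //=; rewrite !andbF.
by rewrite IH; case: (ta a) (tb b) (tc c) => [] [] [].
Qed.

Definition pass A B C (p : protocol B C A) : protocol A B C :=
  @Turn A B C 0 (fun=> [tuple]) (fun=> p).

(** Runs one protocol after the other. *)
Fixpoint both A B C (p : protocol A B C) A' B' C' (q : protocol A' B' C') :
    protocol (A * A') (B * B') (C * C') :=
  match p with
  | Decide va vb vc =>
      pullback q snd snd snd (va \o fst) (vb \o fst) (vc \o fst)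
  | Turn _ msg next =>
      Turn (msg \o fst) (fun s => both (next s) (pass (pass q)))
  end.

Lemma board_both A B C (p : protocol A B C) A' B' C' (q : protocol A' B' C')
    a b c a' b' c' :
  board (both p q) (a, a') (b, b') (c, c') = board p a b c ++ board q a' b' c'.
Proof.
elim: p A' B' C' q a b c a' b' c' => [{}A {}B {}C va vb vc|{}A {}B {}C n msg next IH] * /=.
  by rewrite board_pullback.
by rewrite IH /= catA.
Qed.

Lemma accepts_both A B C (p : protocol A B C) A' B' C' (q : protocol A' B' C')
    a b c a' b' c' :
  accepts (both p q) (a, a') (b, b') (c, c') =
  accepts p a b c && accepts q a' b' c'.
Proof.
elim: p A' B' C' q a b c a' b' c' => [{}A {}B {}C va vb vc|{}A {}B {}C n msg next IH] * /=.
  by rewrite accepts_pullback.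
by rewrite IH.
Qed.

Lemma cc_kron (X Y : problem) : cc (kron X Y) <= cc X + cc Y.
Proof.
have [p sp lep] := cc_protocol X; have [q sq leq] := cc_protocol Y.
apply: (@cc_le (kron X Y) (both p q)) => -[a a'] [b b'] [c c'];
  rewrite inE => /andP[h h'].
  by rewrite accepts_both sp // sq // inE.
by rewrite board_both size_cat leq_add // (lep, leq).
Qed.

Definition reduces (X Y : problem) : Prop :=
  exists (f : inA X -> inA Y) (g : inB X -> inB Y) (h : inC X -> inC Y),
  forall a b c, (a, b, c) \in promise X ->
    (f a, g b, h c) \in promise Y /\
    ((f a, g b, h c) \in accepting Y) = ((a, b, c) \in accepting X).

Lemma cc_reduces (X Y : problem) : reduces X Y -> cc X <= cc Y.
Proof.
move=> [f [g [h fgh]]]; have [q sq leq] := cc_protocol Y.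
apply: (@cc_le X (pullback q f g h xpredT xpredT xpredT)) => a b c abc;
  have [pY aY] := fgh a b c abc.
  by rewrite accepts_pullback /= sq.
by rewrite board_pullback leq.
Qed.

Lemma reduces_pow_add (X : problem) m k :
  reduces (kron_pow X (m + k)) (kron (kron_pow X m) (kron_pow X k)).
Proof.
elim: m => [|m [f [g [h fgh]]]].
  exists (pair tt), (pair tt), (pair tt) => a b c abc.
  by rewrite !inE /=.
exists (fun a => ((a.1, (f a.2).1), (f a.2).2)),
  (fun b => ((b.1, (g b.2).1), (g b.2).2)),
  (fun c => ((c.1, (h c.2).1), (h c.2).2)).
move=> [a a'] [b b'] [c c'] H.
have {H} : ((a, a'), (b, b'), (c, c')) \in promise (kron X (kron_pow X (m + k))) by [].
rewrite inE => /andP[abc /fgh[]].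
rewrite [X in _ -> _ -> _ /\ _ = X](_ : _ = ((a, b, c) \in accepting X) &&
    ((a', b', c') \in accepting (kron_pow X (m + k)))) /=; last first.
  by rewrite -[LHS]/(_ \in accepting (kron X (kron_pow X (m + k)))) inE.
case: (f a') => a1 a2; case: (g b') => b1 b2; case: (h c') => c1 c2 /=.
by rewrite !inE => /andP[-> ->] <-; rewrite abc andbA.
Qed.

Lemma cc_pow_add (X : problem) m k :
  cc (kron_pow X (m + k)) <= cc (kron_pow X m) + cc (kron_pow X k).
Proof. exact: leq_trans (cc_reduces (reduces_pow_add X m k)) (cc_kron _ _). Qed.

(** Fekete's lemma, for integer sequences. *)
Lemma subadditive_cvg (R : realType) (u : nat -> nat) :
    (forall m k, u (m + k) <= u m + u k) ->
  cvgn (fun m => (u m)%:R / m%:R : R)%R.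
Proof.
move=> uD; pose v m : R := ((u m)%:R / m%:R)%R.
have uM d q r : u (q * d + r) <= q * u d + u r.
  elim: q => [|q IH]; first by rewrite !mul0n !add0n.
  by rewrite !mulSn -!addnA (leq_trans (uD _ _)) // leq_add2l.
pose E : set R := [set v m | m in [set m | 0 < m]]%classic.
have v0 m : (0 <= v m)%R by rewrite divr_ge0.
have lbE : lbound E 0%R by move=> _ [m _ <-].
have hE : has_inf E by split; [exists (v 1), 1 | exists 0%R].
apply/cvg_ex; exists (inf E); apply/cvgrPdist_le => e e0.
have e20 : (0 < e / 2)%R by rewrite divr_gt0.
have [_ [d /= d0 <-] vd] := inf_adherent e20 hE.
pose M := d * u 1 + u 0.
have uM' m : u m <= (m %/ d) * u d + M.
  rewrite {1}(divn_eq m d); apply: leq_trans (uM _ _ _) _; rewrite leq_add2l.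
  have := uM 1 (m %% d) 0; rewrite muln1 addn0 => /leq_trans; apply.
  by rewrite leq_add2r leq_mul2r (ltnW (ltn_pmod _ d0)) orbT.
near=> m.
have m0 : 0 < m by near: m; exists 1.
have m0R : (0 < m%:R :> R)%R by rewrite ltr0n.
have d0R : (0 < d%:R :> R)%R by rewrite ltr0n.
have inf_le : (inf E <= v m)%R by apply: ge_inf; [exists 0%R | exists m].
rewrite distrC ger0_norm ?subr_ge0 // lerBlDl.
have Mm : (M%:R / m%:R <= e / 2 :> R)%R.
  rewrite ler_pdivrMr // mulrC -ler_pdivrMr //.
  by near: m; exact: nbhs_infty_ger.
apply: (@le_trans _ _ (v d + M%:R / m%:R)%R); last first.
  by rewrite [leRHS](_ : _ = inf E + e / 2 + e / 2)%R ?lerD // ?(ltW vd) //; lra.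
rewrite /v ler_pdivrMr // mulrDl mulfVK ?gt_eqF // mulrAC.
apply: (@le_trans _ _ ((m %/ d) * u d + M)%N%:R%R); first by rewrite ler_nat.
rewrite natrD lerD2r ler_pdivlMr // -!natrM ler_nat mulnAC mulnC.
by rewrite leq_mul2l leq_divM orbT.
Unshelve. all: by end_near.
Qed.

Lemma acc_cvg (R : realType) (X : problem) :
  cvgn (fun m => (cc (kron_pow X m))%:R / m%:R : R)%R.
Proof. exact: subadditive_cvg (cc_pow_add X). Qed.

(* Main.v *)
(** Player A knows [x] and [y], player B knows [y] and [z], player C knows [z]
    and [x] in each instance.  The instance of [I] becomes easy once everybody
    knows its [x], that of [J] once its [y] is known, that of [K] once its [z]
    is known.  Each player knows two of these three unknowns and can guess the
    third one by assuming that the instance it belongs to is accepting.  Player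
    A publishes the colour of his guess, and B and C compare it with the colours
    of theirs.  It suffices that the colouring of triples forces the three
    guesses to agree as soon as their colours do.

    Such a colouring comes from Behrend's construction: for [x], [y], [z] in
    [Z^d], the colour is [(2y - x - z, |y - x|^2)].  If [(x, y, z')],
    [(x', y, z)] and [(x, y', z)] have the same colour, then the vectors
    [y - x], [y - x'] and [y' - x] have the same norm and the last is the
    midpoint of the other two, so all three are equal.  With digits of about
    [sqrt n] bits there are [2^(n + O(sqrt n))] colours. *)
Require Import Defs.
From mathcomp Require Import all_boot all_order all_algebra.
From mathcomp Require Import all_classical all_reals all_analysis.
From mathcomp Require Import zify ring.

Set Implicit Arguments.
Unset Strict Implicit.
Unset Printing Implicit Defensive.

Import Order.TTheory GRing.Theory Num.Theory.
Import numFieldNormedType.Exports.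

(** The colouring admits no monochromatic nontrivial corner. Primed coordinates are guesses: A, B
    and C colour [(x, y, z')], [(x', y, z)] and [(x, y', z)] respectively. *)
Definition guess_forcing (S T : Type) (col : S -> S -> S -> T) : Prop :=
  forall x y z x' y' z', col x' y z = col x y z' -> col x y' z = col x y z' ->
    [/\ x' = x, y' = y & z' = z].

Lemma nof_guess12 (S : finType) (I : nof_perm S) :
  exists f : S * S -> S, forall x y z, ((x, y, z) \in nof_set I) = (f (x, y) == z).
Proof.
have /choice[f fP] : forall p : S * S, exists z, unique (fun z => (p, z) \in nof_set I) z.
  by move=> [x y]; exact: (nof_perm12 I).
exists f => x y z; have [fI f1] := fP (x, y).
by apply/idP/eqP => [/f1 | <-].
Qed.

Lemma nof_guess23 (S : finType) (I : nof_perm S) :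
  exists f : S * S -> S, forall x y z, ((x, y, z) \in nof_set I) = (f (y, z) == x).
Proof.
have /choice[f fP] : forall p : S * S,
    exists x, unique (fun x => (x, p.1, p.2) \in nof_set I) x.
  by move=> [y z]; exact: (nof_perm23 I).
exists f => x y z; have [/= fI f1] := fP (y, z).
by apply/idP/eqP => [/f1 | <-].
Qed.

Lemma nof_guess13 (S : finType) (I : nof_perm S) :
  exists f : S * S -> S, forall x y z, ((x, y, z) \in nof_set I) = (f (z, x) == y).
Proof.
have /choice[f fP] : forall p : S * S,
    exists y, unique (fun y => (p.2, y, p.1) \in nof_set I) y.
  by move=> [z x]; exact: (nof_perm13 I).
exists f => x y z; have [/= fI f1] := fP (z, x).
by apply/idP/eqP => [/f1 | <-].
Qed.

Lemma nof_input_inj (S : finType) : injective (@nof_input S).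
Proof. by move=> [[x y] z] [[x' y'] z'] [-> -> _ -> _ _]. Qed.

Lemma mem_nof_promise (S : finType) (I : nof_perm S) a b c :
  (a, b, c) \in promise (nof_problem I) ->
  exists x y z, [/\ a = (x, y), b = (y, z) & c = (z, x)].
Proof. by move=> /imsetP[[[x y] z] _ [-> -> ->]]; exists x, y, z. Qed.

Lemma mem_nof_accepting (S : finType) (I : nof_perm S) x y z :
  (((x, y), (y, z), (z, x)) \in accepting (nof_problem I)) =
  ((x, y, z) \in nof_set I).
Proof. exact: (mem_imset (nof_set I) (x, y, z) (@nof_input_inj S)). Qed.

Lemma cc_kron3_le (S : finType) (I J K : nof_perm S) B
    (col : S -> S -> S -> B.-tuple bool) :
  guess_forcing col ->
  cc (kron (kron (nof_problem I) (nof_problem J)) (nof_problem K)) <= B.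
Proof.
move=> colP.
have [f fP] := nof_guess23 I; have [g gP] := nof_guess13 J.
have [h hP] := nof_guess12 K.
pose X := kron (kron (nof_problem I) (nof_problem J)) (nof_problem K).
(* The coloured point takes its [x] from the instance of [I], [y] from that of [J], [z] from that of
   [K]. Roles rotate after A's turn, so [Decide] lists B, C, A. *)
pose p : protocol (inA X) (inB X) (inC X) :=
  @Turn (S * S * (S * S) * (S * S)) (S * S * (S * S) * (S * S))
    (S * S * (S * S) * (S * S)) B
    (fun a => col a.1.1.1 a.1.2.2 (h a.2))
    (fun s => Decide (fun b => col (f b.1.1) b.1.2.1 b.2.2 == s)
      (fun c => col c.1.1.2 (g c.1.2) c.2.1 == s) (fun=> true)).
apply: (@cc_le X p); last first.
  by move=> a b c _; rewrite /= cats0 size_tuple.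
move=> [[a1 a2] a3] [[b1 b2] b3] [[c1 c2] c3].
rewrite inE => /andP[]; rewrite inE => /andP[].
move=> /mem_nof_promise[x1 [y1 [z1 [-> -> ->]]]].
move=> /mem_nof_promise[x2 [y2 [z2 [-> -> ->]]]].
move=> /mem_nof_promise[x3 [y3 [z3 [-> -> ->]]]] /=.
rewrite !inE.
rewrite !mem_nof_accepting fP gP hP andbT.
apply/andP/andP => [[/eqP e1 /eqP e2]|[/andP[/eqP -> /eqP ->] /eqP ->]] //.
by have [-> -> ->] := colP _ _ _ _ _ _ e1 e2; rewrite !eqxx.
Qed.

Lemma card_le_inj (T U : finType) : #|T| <= #|U| -> exists f : T -> U, injective f.
Proof.
move=> TU; exists (fun x => enum_val (widen_ord TU (enum_rank x))).
by move=> x y /enum_val_inj/(congr1 val)/= /ord_inj/enum_rank_inj.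
Qed.

Section Behrend.
Local Open Scope ring_scope.

(* Parallelogram identity: |u - v|^2 = 2|u|^2 + 2|v|^2 - |u + v|^2 *)
Lemma midpoint_sphere d (u v w : 'I_d -> int) :
  (forall i, u i + v i = 2 * w i) ->
  \sum_i u i ^+ 2 = \sum_i w i ^+ 2 -> \sum_i v i ^+ 2 = \sum_i w i ^+ 2 ->
  u =1 v.
Proof.
move=> uvw eu ev i.
have e0 : \sum_i (u i - v i) ^+ 2 = 0.
  rewrite (eq_bigr (fun i => 2 * u i ^+ 2 + 2 * v i ^+ 2 - 4 * w i ^+ 2)).
    by rewrite sumrB big_split /= -!mulr_sumr eu ev; ring.
  by move=> j _; have := uvw j; move: (u j) (v j) (w j) => a b c e; nia.
move/eqP: e0; rewrite psumr_eq0; last by move=> j _; exact: sqr_ge0.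
move=> /allP/(_ i); rewrite mem_index_enum => /(_ isT)/=.
by rewrite sqrf_eq0 subr_eq0 => /eqP.
Qed.

(** The colours outnumber the [q ^ d] points by a factor [4 ^ d * (d * q ^ 2).+1]; balancing [4 ^ d]
    against [q ^ 2] leads to about [sqrt n] digits of [sqrt n] bits. *)
Lemma behrend_coloring d q :
  exists col : {ffun 'I_d -> 'I_q} -> {ffun 'I_d -> 'I_q} -> {ffun 'I_d -> 'I_q} ->
      {ffun 'I_d -> 'I_(4 * q)} * 'I_(d * q ^ 2).+1,
    guess_forcing col.
Proof.
(* The shift by [2 * q - 2] keeps [2y - x - z] nonnegative. *)
have delta_lt (a b c : 'I_q) : (2 * b + (q.-1 - a) + (q.-1 - c) < 4 * q)%N.
  by have := ltn_ord a; have := ltn_ord b; lia.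
pose sqnorm (x y : {ffun 'I_d -> 'I_q}) := (\sum_i absz ((y i)%:Z - (x i)%:Z) ^ 2)%N.
have sqnorm_lt x y : (sqnorm x y < (d * q ^ 2).+1)%N.
  have -> : (d * q ^ 2 = \sum_(i < d) q ^ 2)%N by rewrite sum_nat_const card_ord.
  rewrite ltnS leq_sum // => i _.
  rewrite leq_exp2r //.
  by have := ltn_ord (x i); have := ltn_ord (y i); lia.
exists (fun x y z : {ffun 'I_d -> 'I_q} => ([ffun i => Ordinal (delta_lt (x i) (y i) (z i))],
  Ordinal (sqnorm_lt x y))) => x y z x' y' z'.
move=> [/ffunP d1 n1] [/ffunP d2 n2].
have sqnormE u v : (sqnorm u v)%:Z = \sum_i ((v i)%:Z - (u i)%:Z) ^+ 2.
  rewrite -natz /sqnorm natr_sum; apply: eq_bigr => i _.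
  by rewrite natz -abszX gez0_abs // sqr_ge0.
(* Digits are below [q], so the truncated subtractions from [q.-1] are exact and the shift cancels
   over the integers. *)
have dlt i : [/\ 2 * (y i)%:Z - (x' i)%:Z - (z i)%:Z
                 = 2 * (y i)%:Z - (x i)%:Z - (z' i)%:Z
  & 2 * (y' i)%:Z - (x i)%:Z - (z i)%:Z = 2 * (y i)%:Z - (x i)%:Z - (z' i)%:Z].
  have /(congr1 val) := d1 i; have /(congr1 val) := d2 i; rewrite !ffunE /=.
  have := ltn_ord (x i); have := ltn_ord (x' i); have := ltn_ord (z i).
  by have := ltn_ord (z' i); split; lia.
have /(congr1 Posz) := n1; have /(congr1 Posz) := n2; rewrite !sqnormE => e2 e1.
(* The triples [(x', y, z)] and [(x, y', z)] share [z], so their first colour components give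
   [2y - x' = 2y' - x]: this is the midpoint relation. *)
have H := @midpoint_sphere d (fun i => (y i)%:Z - (x i)%:Z)
  (fun i => (y i)%:Z - (x' i)%:Z) (fun i => (y' i)%:Z - (x i)%:Z).
have {}H : forall i, (y i)%:Z - (x i)%:Z = (y i)%:Z - (x' i)%:Z.
  by apply: H => [i| |]; rewrite ?e1 ?e2 //; have [] := dlt i; lia.
have xyz i : [/\ (x' i)%:Z = x i, (y' i)%:Z = y i & (z' i)%:Z = z i].
  by have := H i; have [] := dlt i; split; lia.
by split; apply/ffunP => i; apply/ord_inj; have [[ex] [ey] [ez]] := xyz i.
Qed.

End Behrend.

(** Forcing survives injective recoding of points and of colours, so only cardinalities matter. *)
Lemma tuple_coloring n d k B :
  n <= k * d -> (4 * 2 ^ k) ^ d * (d * (2 ^ k) ^ 2).+1 <= 2 ^ B ->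
  exists col : n.-tuple bool -> n.-tuple bool -> n.-tuple bool -> B.-tuple bool,
    guess_forcing col.
Proof.
move=> nkd leB.
have [e e_inj] : exists e : n.-tuple bool -> {ffun 'I_d -> 'I_(2 ^ k)}, injective e.
  apply: card_le_inj.
  by rewrite card_tuple card_bool card_ffun !card_ord -expnM leq_exp2l.
have [c cP] := behrend_coloring d (2 ^ k).
have [e' e'_inj] : exists e' : {ffun 'I_d -> 'I_(4 * 2 ^ k)} *
    'I_(d * (2 ^ k) ^ 2).+1 -> B.-tuple bool, injective e'.
  by apply: card_le_inj; rewrite card_prod card_tuple card_bool card_ffun !card_ord.
exists (fun x y z => e' (c (e x) (e y) (e z))) => x y z x' y' z'.
by move=> /e'_inj e1 /e'_inj e2; have [] := cP _ _ _ _ _ _ e1 e2;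
  split; apply: e_inj.
Qed.

Lemma cc_kron3_sqrt n (I J K : nof_perm (n.-tuple bool)) k :
  k ^ 2 <= n < k.+1 ^ 2 ->
  cc (kron (kron (nof_problem I) (nof_problem J)) (nof_problem K)) <= n + 13 * k.
Proof.
case: k => [|k] /andP[kn nk].
  have [|col colP] := @tuple_coloring n 0 0 0 _ isT; first by lia.
  by apply: leq_trans (cc_kron3_le I J K colP) _.
(* With [K = k.+1], [n < (K + 1)^2] gives [n <= K * (K + 2)], so [K + 2] digits of [K] bits suffice.
   The colour takes [K^2 + 7K + 6] bits, at most [n + 13K] since [K >= 1]. *)
have [||col colP] := @tuple_coloring n k.+3 k.+1 (k.+3 ^ 2 + 3 * k.+1 + 2); first by lia.
  rewrite -[4]/(2 ^ 2) -expnD -!expnM.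
  rewrite [leqRHS](_ : _ = 2 ^ ((2 + k.+1) * k.+3) * 2 ^ (k.+3 + k.+1 * 2)); last first.
    by rewrite -expnD; congr (2 ^ _); lia.
  by rewrite leq_mul2l [2 ^ (k.+3 + _)]expnD ltn_mul2r !expn_gt0 ltn_expl // orbT.
by apply: leq_trans (cc_kron3_le I J K colP) _; lia.
Qed.

Lemma ex_floor_sqrt n : exists k, k ^ 2 <= n < k.+1 ^ 2.
Proof.
have ub k : k ^ 2 <= n -> k <= n.
  by apply: leq_trans; case: k => // k; rewrite -mulnn leq_pmulr.
case: (ex_maxnP (ex_intro (fun k => k ^ 2 <= n) 0 isT) ub) => k kn kmax.
by exists k; rewrite kn ltnNge; apply/negP => /kmax; rewrite ltnn.
Qed.

Lemma reduces_pow3 (X : problem) : reduces (kron_pow X 3) (kron (kron X X) X).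
Proof.
exists (fun a => ((a.1, a.2.1), a.2.2.1)), (fun a => ((a.1, a.2.1), a.2.2.1)),
  (fun a => ((a.1, a.2.1), a.2.2.1)).
move=> [a1 [a2 [a3 []]]] [b1 [b2 [b3 []]]] [c1 [c2 [c3 []]]] /=.
by rewrite !inE /= !andbT => /and3P[-> -> ->]; rewrite andbA.
Qed.

(** By subadditivity the bound holds for every term along the multiples of [d.+1], and this
    subsequence has the same limit. *)
Lemma acc_le_pow (R : realType) (X : problem) d :
  (acc R X <= (cc (kron_pow X d.+1))%:R / d.+1%:R)%R.
Proof.
pose u m := cc (kron_pow X m); pose v m : R := ((u m)%:R / m%:R)%R.
have uM q : u (q.+1 * d.+1) <= q.+1 * u d.+1.
  elim: q => [|q IH]; first by rewrite !mul1n.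
  by rewrite mulSn [leqRHS]mulSn (leq_trans (cc_pow_add _ _ _)) // leq_add2l.
have sub : ((fun q => q.+1 * d.+1) @ \oo --> \oo)%classic.
  apply/cvgnyPge => m; near=> q; apply: (@leq_trans q).
    by near: q; exact: nbhs_infty_ge.
  by rewrite (leq_trans (leqnSn q)) // leq_pmulr.
have vq : ((v \o (fun q => q.+1 * d.+1)) @ \oo --> acc R X)%classic.
  have vc : (v @ \oo --> acc R X)%classic by exact: acc_cvg.
  by apply: cvg_comp sub vc.
rewrite -(cvg_lim _ vq) //; apply: limr_le; first by apply/cvg_ex; exists (acc R X).
apply: nearW => q /=; rewrite /v ler_pdivrMr ?ltr0n //.
rewrite mulrAC ler_pdivlMr ?ltr0n // -!natrM ler_nat.
by rewrite mulnA [cc _ * _]mulnC leq_mul2r uM orbT.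
Unshelve. all: by end_near.
Qed.

Local Open Scope classical_set_scope.
Local Open Scope ring_scope.

Lemma cvg_inv_sqrt (R : realType) :
  (fun n => 13 / Num.sqrt n%:R : R) @ \oo --> (0 : R).
Proof.
rewrite -(cvg_shiftS (fun n => 13 / Num.sqrt n%:R : R)) /=.
have sqrt_cvg : Num.sqrt (harmonic n : R) @[n --> \oo] --> Num.sqrt (0 : R).
  exact: continuous_cvg (@sqrt_continuous R 0) (@cvg_harmonic R).
have : 13 * Num.sqrt (harmonic n : R) @[n --> \oo] --> 13 * Num.sqrt (0 : R).
  by apply: cvgM; [exact: cvg_cst | exact: sqrt_cvg].
rewrite sqrtr0 mulr0; under eq_fun do rewrite /harmonic sqrtrV //.
exact.
Qed.

Lemma cc_kron3_real (R : realType) n (I J K : nof_perm (n.-tuple bool)) :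
  (cc (kron (kron (nof_problem I) (nof_problem J)) (nof_problem K)))%:R
    <= (1 + 13 / Num.sqrt n%:R) * n%:R :> R.
Proof.
have [k kn] := ex_floor_sqrt n.
apply: (@le_trans _ _ (n + 13 * k)%N%:R).
  by rewrite ler_nat (cc_kron3_sqrt I J K kn).
(* At [n = 0] the factor [n] removes the error term, whatever the division by zero yields. *)
have [n0|n0] := posnP n.
  have -> : k = 0 by move: kn; rewrite n0; case: (k).
  by rewrite n0 !mulr0.
rewrite natrD natrM [in leRHS]mulrDl mul1r lerD2l -mulrA ler_pM2l //.
rewrite -{2}(@sqr_sqrtr R n%:R) // expr2 mulKf ?gt_eqF ?sqrtr_gt0 ?ltr0n //.
rewrite -(ger0_norm (ler0n R k)) -sqrtr_sqr ler_wsqrtr // -natrX ler_nat.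
by case/andP: kn.
Qed.

Theorem mainTheorem6 (R : realType) :
  (exists2 eps : nat -> R, eps @ \oo --> (0 : R) &
    forall (n : nat) (I J K : nof_perm (n.-tuple bool)),
      (cc (kron (kron (nof_problem I) (nof_problem J)) (nof_problem K)))%:R
        <= (1 + eps n) * n%:R) /\
  (exists2 eps : nat -> R, eps @ \oo --> (0 : R) &
    forall (n : nat) (I : nof_perm (n.-tuple bool)),
      acc R (nof_problem I) <= (1 + eps n) * (n%:R / 3)).
Proof.
split; exists (fun n => 13 / Num.sqrt n%:R); try exact: cvg_inv_sqrt.
  by move=> n I J K; exact: cc_kron3_real.
(* The argument [2] selects the third power, which reduces to three copies of [I], so the same error
   term serves. *)
move=> n I; apply: le_trans (acc_le_pow R _ 2) _.
rewrite mulrA ler_pM2r ?invr_gt0 ?ltr0n //.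
apply: le_trans (cc_kron3_real R I I I).
by rewrite ler_nat; exact: cc_reduces (reduces_pow3 _).
Qed.
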